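(* Let $V_1,V_2,V_3:\mathbb{R}\to\mathbb{R}$ be lower semicontinuous functions with $\lim_{|x|\to\infty}(V_i(x)-2\log|x|)=\infty$ for $i=1,2,3$, such that for some $a\in(0,1)$, $$aV_1(x)+(1-a)V_2(y)\ge V_3(ax+(1-a)y)\quad\text{for all }x,y\in\mathbb{R}.$$ Then $$aE_{V_1}(\mu_{V_1})+(1-a)E_{V_2}(\mu_{V_2})\ge E_{V_3}(\mu_{V_3}).$$
   Context: For a lower semicontinuous $V:\mathbb{R}\to\mathbb{R}$ with $\lim_{|x|\to\infty}(V(x)-2\log|x|)=\infty$ and a probability measure $\mu$ on $\mathbb{R}$, $$E_V(\mu)=\int V(x)\,\mu(dx)-\iint\log|x-y|\,\mu(dx)\mu(dy)$$ whenever both integrals exist and are finite, and $E_V(\mu)=+\infty$ otherwise. It is known that $E_V$ has a unique minimizer $\mu_V$ among all probability measures on $\mathbb{R}$, and that it is compactly supported. *)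

(* Defs.v *)
From HB Require Import structures.
From mathcomp Require Import all_boot all_order all_algebra.
From mathcomp Require Import all_classical all_reals all_analysis.
Set Implicit Arguments.
Unset Strict Implicit.
Unset Printing Implicit Defensive.
Import Order.TTheory GRing.Theory Num.Theory.
Import numFieldNormedType.Exports.
Local Open Scope classical_set_scope.
Local Open Scope ring_scope.

(* V : R -> R is lower semicontinuous with V(x) - 2 log|x| -> +oo as
   |x| -> oo; on the line, |x| -> oo means x -> +oo and x -> -oo. *)
Definition admissible_potential (R : realType) (V : R -> R) : Prop :=
  [/\ lower_semicontinuous (EFin \o V),
      (V x - 2 * ln `|x|) @[x --> +oo] --> +oo &
      (V x - 2 * ln `|x|) @[x --> -oo] --> +oo].

(* The extended logarithm lne is used because ln 0 = 0 in the library, whereas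
   here log|x - y| = -oo on the diagonal (in particular, a measure with an atom
   has energy +oo). *)
Definition log_dist (R : realType) (z : R * R) : \bar R :=
  lne (`|z.1 - z.2|%:E).

Definition energy (R : realType) (V : R -> R)
    (mu : probability (measurableTypeR R) R) : \bar R :=
  (if `[< mu.-integrable [set: measurableTypeR R] (EFin \o V) /\
          (mu \x mu).-integrable [set: measurableTypeR R * measurableTypeR R]
            (@log_dist R) >]
   then \int[mu]_x (V x)%:E - \int[mu \x mu]_z log_dist z
   else +oo)%E.

Definition energy_minimizer (R : realType) (V : R -> R)
    (mu : probability (measurableTypeR R) R) : Prop :=
  forall nu : probability (measurableTypeR R) R, (energy V mu <= energy V nu)%E.

(* Main.v *)
Require Import Defs.
From HB Require Import structures.
From mathcomp Require Import all_boot all_order all_algebra.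
From mathcomp Require Import all_classical all_reals all_analysis.
From mathcomp Require Import measurable_realfun ring lra.
Set Implicit Arguments.
Unset Strict Implicit.
Unset Printing Implicit Defensive.
Import Order.TTheory GRing.Theory Num.Theory.
Import numFieldNormedType.Exports.
Local Open Scope classical_set_scope.
Local Open Scope ring_scope.

(** The inequality is obtained by displacement along a comonotone coupling.
    Let [P] be the uniform law on the open unit interval and let [X1], [X2] be
    the quantile functions of [mu1] and [mu2]: they have laws [mu1] and [mu2]
    under [P], and the increments [X1 u - X1 v] and [X2 u - X2 v] never have
    opposite signs.  Let [nu] be the law of [a X1 + (1 - a) X2].  Since [mu3]
    minimizes the third energy, it suffices to bound the third energy of [nu]
    by the weighted sum of the two other energies.

    The hypothesis on the potentials, applied at [x = X1 u] and [y = X2 u] and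
    integrated over [u], bounds the potential term of [nu].  Increments of
    weakly equal signs satisfy [|a s + (1 - a) t| = a |s| + (1 - a) |t|], so
    the concavity of the logarithm ([lne_concave]) bounds the interaction term
    pointwise, on the diagonal included.

    When one of the first two energies is infinite there is nothing to prove.
    Otherwise the two pointwise bounds also give half of the integrability
    required for the energy of [nu].  The other half comes from the growth of
    [V3]: for some constant [C], [ln (1 + |x|) <= V3 x + C] for all [x]
    ([potential_growth]), which bounds [V3] from below and, as
    [|x - y| <= (1 + |x|) (1 + |y|)], bounds the kernel from above by
    [(V3 x + C) + (V3 y + C)]. *)

(** * Image measures *)

Section image_measure.
Local Open Scope ereal_scope.
Context d1 d2 (X : measurableType d1) (Y : measurableType d2) (R : realType).
Variables (P : {measure set X -> \bar R}) (mu : {measure set Y -> \bar R}).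
Variable phi : X -> Y.
Hypothesis mphi : measurable_fun [set: X] phi.
Hypothesis muE : forall A, measurable A -> mu A = P (phi @^-1` A).

Lemma integrable_image (f : Y -> \bar R) : measurable_fun [set: Y] f ->
  mu.-integrable [set: Y] f <-> P.-integrable [set: X] (f \o phi).
Proof.
move=> mf.
have E : \int[mu]_y `|f y| = \int[P]_x `|(f \o phi) x|.
  rewrite (@eq_measure_integral _ _ _ _ (pushforward P phi)); last first.
    by move=> A mA _; exact: muE.
  by rewrite ge0_integral_pushforward//; exact: measurableT_comp.
split=> /integrableP[_ fi]; apply/integrableP; split => //.
- exact: measurableT_comp.
- by rewrite -E.
- by rewrite E.
Qed.

Lemma integral_image (f : Y -> \bar R) : measurable_fun [set: Y] f ->
  P.-integrable [set: X] (f \o phi) ->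
  \int[mu]_y f y = \int[P]_x f (phi x).
Proof.
move=> mf fi; rewrite (@eq_measure_integral _ _ _ _ (pushforward P phi)).
  by rewrite integral_pushforward.
by move=> A mA _; exact: muE.
Qed.

End image_measure.

Section product_image_measure.
Local Open Scope ereal_scope.
Context d1 d2 (X : measurableType d1) (Y : measurableType d2) (R : realType).
Variables (P : probability X R) (mu : probability Y R) (phi : X -> Y).
Hypothesis mphi : measurable_fun [set: X] phi.
Hypothesis muE : forall A, measurable A -> mu A = P (phi @^-1` A).

Let phi2 (z : X * X) := (phi z.1, phi z.2).

Lemma measurable_pair_image : measurable_fun [set: X * X] phi2.
Proof. by apply: measurable_fun_pair => /=; apply: measurableT_comp. Qed.

Let phi2_pack : {mfun (X * X)%type >-> (Y * Y)%type} :=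
  HB.pack phi2 (isMeasurableFun.Build _ _ _ _ _ measurable_pair_image).

(** The square of an image measure is the image of the square. *)
Lemma product_image A : measurable A ->
  (mu \x mu) A = (P \x P) (phi2 @^-1` A).
Proof.
move=> mA.
apply: (product_measure_unique (m' := pushforward (P \x P) phi2_pack)) => //.
move=> B C mB mC.
have mphiS D : measurable D -> measurable (phi @^-1` D).
  by move=> mD; rewrite -[phi @^-1` _]setTI; exact: mphi.
have E : (P \x P) ((phi @^-1` B) `*` (phi @^-1` C)) = mu B * mu C.
  by rewrite product_measure1E ?muE//; exact: mphiS.
exact: E.
Qed.

End product_image_measure.

Section integrability.
Local Open Scope ereal_scope.

Lemma integrable_marginal d (X : measurableType d) (R : realType)
    (P : probability X R) (f g : X -> \bar R) :
  P.-integrable [set: X] f -> P.-integrable [set: X] g ->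
  (P \x P).-integrable [set: X * X] (fun z => f z.1 + g z.2).
Proof.
move=> fi gi; apply: integrableD => //.
- apply/(@integrable_image _ _ _ _ _ (P \x P) P fst) => // [A mA|].
  + have -> : fst @^-1` A = A `*` [set: X].
      by apply/seteqP; split => -[x y] //= [].
    have E : (P \x P) (A `*` [set: X]) = P A.
      rewrite product_measure1E// -[RHS]mule1; congr (_ * _).
      exact: probability_setT.
    exact/esym/E.
  + exact: measurable_int fi.
- apply/(@integrable_image _ _ _ _ _ (P \x P) P snd) => // [A mA|].
  + have -> : snd @^-1` A = [set: X] `*` A.
      by apply/seteqP; split => -[x y] //= [].
    have E : (P \x P) ([set: X] `*` A) = P A.
      rewrite product_measure1E// -[RHS]mul1e; congr (_ * _).
      exact: probability_setT.
    exact/esym/E.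
  + exact: measurable_int gi.
Qed.

(** The bounds [g] and [h] may be infinite at some points and need not have a
    sign. *)
Lemma integrable_sandwich d (T : measurableType d) (R : realType)
    (mu : {measure set T -> \bar R}) (f g h : T -> \bar R) :
  measurable_fun [set: T] f ->
  mu.-integrable [set: T] g -> mu.-integrable [set: T] h ->
  (forall x, g x <= f x <= h x) -> mu.-integrable [set: T] f.
Proof.
move=> mf gi hi gfh.
apply: (@le_integrable _ _ _ mu _ measurableT _
  (fun x => `|g x| + `|h x|)) => //.
- move=> x _; have /andP[gf fh] := gfh x.
  rewrite [leRHS]gee0_abs ?adde_ge0//.
  have [f0|f0] := leP 0 (f x).
    by rewrite gee0_abs// (le_trans fh)// (le_trans (lee_abs _))// leeDr.
  rewrite lte0_abs// (@le_trans _ _ `|g x|)//; last by rewrite leeDl.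
  by rewrite -abseN (le_trans _ (lee_abs _))// leeN2.
- by apply: integrableD => //; exact: integrable_abse.
Qed.

End integrability.

(** * The logarithmic kernel *)

Lemma ln_concave (R : realType) (a s t : R) : 0 < a < 1 -> 0 < s -> 0 < t ->
  a * ln s + (1 - a) * ln t <= ln (a * s + (1 - a) * t).
Proof.
move=> /andP[a0 a1] s0 t0.
have a0' : 0 <= a by exact: ltW.
have a1' : a <= 1 by exact: ltW.
have := concave_ln (Itv01 a0' a1') s0 t0.
by rewrite !convRE.
Qed.

(** Concavity of [log|.|] on pairs of reals of weakly equal signs.  If [s] or
    [t] vanishes, the left-hand side is [-oo]. *)
Lemma lne_concave (R : realType) (a s t : R) : 0 < a < 1 -> 0 <= s * t ->
  (a%:E * lne `|s|%:E + (1 - a)%:E * lne `|t|%:E <=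
    lne `|a * s + (1 - a) * t|%:E)%E.
Proof.
move=> a01 st; have /andP[a0 a1] := a01.
have [->|s0] := eqVneq s 0.
  by rewrite normr0 [lne 0]le0_lneNy// gt0_muleNy ?lte_fin// addNye leNye.
have [->|t0] := eqVneq t 0.
  rewrite normr0 [lne 0]le0_lneNy// gt0_muleNy ?lte_fin ?subr_gt0//.
  by rewrite addeNy leNye.
have -> : `|a * s + (1 - a) * t| = a * `|s| + (1 - a) * `|t|.
  have [sp|sn] := ltP 0 s.
    have tp : 0 <= t by rewrite -(pmulr_rge0 t sp).
    by rewrite !ger0_norm ?addr_ge0 ?mulr_ge0 ?ltW ?subr_gt0//
               lt_neqAle eq_sym t0.
  have {}sn : s < 0 by rewrite lt_neqAle s0.
  have tn : t <= 0 by rewrite -(nmulr_rge0 t sn).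
  rewrite (ler0_norm tn) (ltr0_norm sn) ler0_norm; first by ring.
  by nra.
have sp : 0 < `|s| by rewrite normr_gt0.
have tp : 0 < `|t| by rewrite normr_gt0.
rewrite !lne_EFin ?addr_gt0 ?mulr_gt0 ?subr_gt0// -!EFinM -EFinD lee_fin.
exact: ln_concave.
Qed.

Lemma log_dist_le (R : realType) (x y : R) :
  (log_dist (x, y) <= (ln (1 + `|x|) + ln (1 + `|y|))%:E)%E.
Proof.
have x1 : 0 < 1 + `|x| by rewrite ltr_pwDl.
have y1 : 0 < 1 + `|y| by rewrite ltr_pwDl.
rewrite /log_dist /= -lnM ?posrE//.
case: ifPn => [|]; first by rewrite leNye.
rewrite -ltNge => xy; rewrite lee_fin ler_ln ?posrE ?mulr_gt0//.
rewrite (le_trans (ler_normB _ _))// mulrDl mul1r mulrDr mulr1.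
have : 0 <= `|x| * `|y| by rewrite mulr_ge0.
by lra.
Qed.

Lemma measurable_log_dist (R : realType) :
  measurable_fun [set: measurableTypeR R * measurableTypeR R] (@log_dist R).
Proof.
rewrite /log_dist /=.
have mD : measurable_fun [set: measurableTypeR R * measurableTypeR R]
    (fun z => `|z.1 - z.2| : measurableTypeR R).
  by apply: measurableT_comp => //; apply: measurable_funB.
apply: measurable_fun_if => //.
- exact: measurable_fun_ler.
- apply: measurable_funTS; apply/measurable_EFinP.
  exact: measurableT_comp.
Qed.

(** * Admissible potentials *)

Lemma measurable_potential (R : realType) (V : R -> R) :
  admissible_potential V ->
  measurable_fun [set: measurableTypeR R] (EFin \o V).
Proof. by move=> [lV _ _]; exact: lower_semicontinuous_measurable. Qed.

Lemma lsc_bounded_below (R : realType) (V : R -> R) (a b : R) :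
  lower_semicontinuous (EFin \o V) ->
  exists m, forall x, a <= x <= b -> - m <= V x.
Proof.
move=> lV.
have /compact_near_coveringP/(_ nat \oo (fun n x => - n%:R <= V x)) :=
  @segment_compact _ a b.
move=> [].
  move=> x _.
  have V1 : ((V x - 1)%:E < (EFin \o V) x)%E by rewrite lte_fin ltrBlDr ltrDl.
  have [U xU UV] := lV x (V x - 1) V1.
  near=> y n => /=.
  have : V x - 1 < V y by rewrite -lte_fin; apply: UV; near: y.
  have : 1 - V x <= n%:R by near: n; exact: nbhs_infty_ger.
  lra.
move=> N _ /(_ N (leqnn N)) HN.
by exists N%:R => x axb; apply: HN; rewrite /= in_itv.
Unshelve. all: by end_near. Qed.

(** Beyond a radius [M >= 2], [V x >= 2 ln |x| = ln (x ^ 2) >= ln (1 + |x|)];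
    inside, [V] is bounded below by compactness. *)
Lemma potential_growth (R : realType) (V : R -> R) :
  admissible_potential V ->
  exists C, forall x, ln (1 + `|x|) <= V x + C.
Proof.
move=> hV.
have [lV Vy VNy] := hV.
have [M1 [_ H1]] : \forall x \near +oo, 0 <= V x - 2 * ln `|x|.
  by move/cvgryPge : Vy; exact.
have [M2 [_ H2]] : \forall x \near -oo, 0 <= V x - 2 * ln `|x|.
  by move/cvgryPge : VNy; exact.
pose M := Num.max 2 (Num.max (M1 + 1) (1 - M2)).
have M_2 : 2 <= M by rewrite le_max lexx.
have M_M1 : M1 < M by rewrite !lt_max ltrDl ltr01 orbT.
have M_M2 : - M < M2.
  by rewrite ltrNl !lt_max; apply/orP; right; apply/orP; right; lra.
have [m Hm] := lsc_bounded_below (- M) M lV.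
exists (Num.max 0 (m + ln (1 + M))) => x.
have [xM|Mx] := leP `|x| M.
  have : - m <= V x by apply: Hm; rewrite -ler_norml.
  have : ln (1 + `|x|) <= ln (1 + M).
    by rewrite ler_ln ?posrE ?lerD2l ?ltr_pwDl//; lra.
  have : m + ln (1 + M) <= Num.max 0 (m + ln (1 + M)).
    by rewrite le_max lexx orbT.
  lra.
have : 0 <= Num.max 0 (m + ln (1 + M)) by rewrite le_max lexx.
suff : 2 * ln `|x| <= V x.
  suff : ln (1 + `|x|) <= 2 * ln `|x| by lra.
  rewrite mulr_natl -lnXn; last by lra.
  rewrite ler_ln ?posrE ?exprn_gt0 ?ltr_pwDl//; last by lra.
  by rewrite expr2; nra.
rewrite -subr_ge0.
have [x0|x0] := leP 0 x.
  by apply: H1; move: Mx; rewrite ger0_norm//; lra.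
by apply: H2; move: Mx; rewrite ltr0_norm//; lra.
Qed.

(** * Quantile functions *)

(** The uniform law on the open unit interval, as the restriction of Lebesgue
    measure; it is a measure on the whole line. *)
Definition unit_uniform (R : realType) : set (measurableTypeR R) -> \bar R :=
  mrestr (@lebesgue_measure R)
    (measurable_itv `]0%R, 1%R[ :
      measurable (`]0%R, 1%R[%classic : set (measurableTypeR R))).

HB.instance Definition _ (R : realType) := Measure.on (@unit_uniform R).

Lemma unit_uniform_setT (R : realType) : @unit_uniform R [set: _] = 1%E.
Proof.
rewrite /unit_uniform /mrestr setTI lebesgue_measure_itv/= lte_fin ltr01.
by rewrite oppr0 adde0.
Qed.

HB.instance Definition _ (R : realType) :=
  @Measure_isProbability.Build _ _ R (@unit_uniform R) (@unit_uniform_setT R).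

(** The identity on the open unit interval, and the constant [1 / 2]
    elsewhere.  Precomposing quantile functions with it makes their
    comonotonicity hold at all reals instead of almost everywhere, although the
    composites need not be monotone. *)
Definition unit_clip {R : realType} (u : R) : R :=
  if 0 < u < 1 then u else 2^-1.

(** The quantile function, i.e. the left-continuous generalized inverse of the
    distribution function.  It is meaningful for [0 < u < 1] only. *)
Definition quantile {R : realType} (mu : probability (measurableTypeR R) R)
    (u : R) : R :=
  inf [set x : R | (u%:E <= mu `]-oo, x]%classic)%E].

Section quantile.
Context (R : realType) (mu : probability (measurableTypeR R) R).

Let idTR : measurableTypeR R -> R := idfun.
#[local] HB.instance Definition _ :=
  @isMeasurableFun.Build _ _ _ _ idTR (@measurable_id _ _ setT).
Let Fe : R -> \bar R := cdf (idTR : {RV mu >-> R}).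
Let F (x : R) : R := fine (Fe x).

Let FE x : mu `]-oo, x]%classic = (F x)%:E.
Proof. by rewrite /F fineK// /Fe fin_num_measure. Qed.

Let F_nd x y : x <= y -> F x <= F y.
Proof.
move=> xy; rewrite -lee_fin -!FE.
exact: (cdf_nondecreasing (idTR : {RV mu >-> R})).
Qed.

Let F01 x : 0 <= F x <= 1.
Proof. by rewrite -!lee_fin -FE measure_ge0 probability_le1. Qed.

Lemma unit_clip_in01 (u : R) : 0 < unit_clip u < 1.
Proof. by rewrite /unit_clip; case: ifPn => // _; lra. Qed.

(** The infimum defining the quantile is attained, by right continuity of the
    distribution function. *)
Lemma quantile_le (u x : R) : 0 < u < 1 ->
  (quantile mu u <= x) = (u%:E <= mu `]-oo, x]%classic)%E.
Proof.
move=> /andP[u0 u1]; rewrite FE lee_fin.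
have SE : [set x : R | (u%:E <= mu `]-oo, x]%classic)%E] = [set x | u <= F x].
  by apply/seteqP; split => y /=; rewrite FE lee_fin.
rewrite /quantile SE.
have lbS : has_lbound [set x | u <= F x].
  have [M [_ HM]] : \forall x \near -oo, F x < u.
    have /fine_cvg := cvg_cdfNy0 (idTR : {RV mu >-> R}).
    by move=> /cvgr_lt; apply.
  exists (M - 1) => y /= uy.
  rewrite leNgt; apply/negP => yM.
  have : F y < u by apply: HM; rewrite (lt_trans yM)// ltrBlDr ltrDl.
  by rewrite ltNge uy.
have nS : [set x | u <= F x] !=set0.
  have [M [_ HM]] : \forall x \near +oo, u < F x.
    have /fine_cvg := cvg_cdfy1 (idTR : {RV mu >-> R}).
    by move=> /cvgr_gt; apply.
  by exists (M + 1); apply/ltW/HM; rewrite ltrDl.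
apply/idP/idP => [qx|ux]; last exact: ge_inf.
rewrite leNgt; apply/negP => xu.
have : \forall y \near x^'+, F y < u.
  have : Fe y @[y --> x^'+] --> Fe x :=
    @cdf_right_continuous _ _ _ _ (idTR : {RV mu >-> R}) x.
  rewrite [Fe x]FE => /fine_cvg.
  by move=> /cvgr_lt; apply.
move=> Hr.
have [y [xy yu]] : exists y, x < y /\ F y < u.
  near x^'+ => y.
  by exists y; split; near: y => //; exact: nbhs_right_gt.
have : y <= inf [set x | u <= F x].
  apply: lb_le_inf => // z /= uz; rewrite leNgt; apply/negP => zy.
  by have := F_nd (ltW zy); lra.
by rewrite leNgt (le_lt_trans qx).
Unshelve. all: by end_near. Qed.

(** The quantile function as a total random variable under [unit_uniform]. *)
Definition quantile_rv (u : measurableTypeR R) : measurableTypeR R :=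
  quantile mu (unit_clip u).

Lemma quantile_rv_preimage (x : R) :
  quantile_rv @^-1` `]-oo, x]%classic = unit_clip @^-1` `]-oo, F x]%classic.
Proof.
by apply/seteqP; split => u;
  rewrite /= !in_itv/= quantile_le ?unit_clip_in01// FE lee_fin.
Qed.

Lemma measurable_unit_clip :
  measurable_fun [set: measurableTypeR R]
    (unit_clip : measurableTypeR R -> measurableTypeR R).
Proof.
apply: measurable_fun_ifT => //.
by apply: measurable_and; exact: measurable_fun_ltr.
Qed.

Lemma measurable_quantile_rv :
  measurable_fun [set: measurableTypeR R] quantile_rv.
Proof.
apply: (measurability (@RGenOInfty.G R)) => [|/= _ [_] [r] -> <-].
  exact: RGenOInfty.measurableE.
have -> : [set: measurableTypeR R] `&` quantile_rv @^-1` `]r, +oo[%classic =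
    ~` (quantile_rv @^-1` `]-oo, r]%classic).
  by rewrite setTI -setCitvl preimage_setC.
rewrite quantile_rv_preimage; apply: measurableC.
by rewrite -[_ @^-1` _]setTI; exact: measurable_unit_clip.
Qed.

Lemma quantile_rv_distribution_ray (x : R) :
  @unit_uniform R (quantile_rv @^-1` `]-oo, x]%classic) = mu `]-oo, x]%classic.
Proof.
rewrite quantile_rv_preimage FE /unit_uniform /mrestr.
have /andP[F0 F1] := F01 x.
have [F11|F11] := ltP (F x) 1.
  rewrite (_ : _ `&` _ = `]0, F x]%classic); last first.
    apply/seteqP; split => u; rewrite /= !in_itv/= /unit_clip.
      by move=> [] /[swap] u01; rewrite u01 => ->; lra.
    by move=> uF; rewrite (_ : 0 < u < 1); lra.
  rewrite lebesgue_measure_itv/= lte_fin oppr0 adde0; case: ltP => //.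
  by move=> F0'; congr (_ %:E); lra.
rewrite (_ : _ `&` _ = `]0, 1[%classic); last first.
  apply/seteqP; split => u; rewrite /= !in_itv/=; first by case.
  by move=> u01; split => //; rewrite /unit_clip u01; lra.
rewrite lebesgue_measure_itv/= lte_fin ltr01 oppr0 adde0.
by congr (_ %:E); lra.
Qed.

(** Inverse transform sampling: the quantile function has law [mu]. *)
Lemma quantile_rv_distribution (A : set (measurableTypeR R)) : measurable A ->
  mu A = @unit_uniform R (quantile_rv @^-1` A).
Proof.
move=> mA.
pose X : {mfun measurableTypeR R >-> measurableTypeR R} :=
  HB.pack quantile_rv (isMeasurableFun.Build _ _ _ _ _ measurable_quantile_rv).
pose nu : probability _ _ := distribution (@unit_uniform R) X.
(* Both laws agree on the half-open intervals, which generate the Borel sets. *)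
have mG : @measurable _ (measurableTypeR R) = <<s @ocitv R >> by [].
have G (n : nat) : @ocitv R `](- n%:R)%R, n%:R]%classic by exact: is_ocitv.
have GT : \bigcup_n `](- n%:R)%R, n%:R]%classic = [set: measurableTypeR R].
  rewrite -subTset => x _; exists (Num.truncn `|x|).+1 => //=.
  have := truncnS_gt `|x|; rewrite ltr_norml in_itv/= => /andP[-> xn].
  exact: ltW.
have := @measure_unique _ R (measurableTypeR R) (@ocitv R) _ mG (@ocitvI R)
  G GT mu nu.
apply => //.
- move=> _ [[a b] /= _ <-].
  change (mu `]a, b]%classic = nu `]a, b]%classic).
  have E (m : probability (measurableTypeR R) R) : a <= b ->
      m `]a, b]%classic = (m `]-oo, b]%classic - m `]-oo, a]%classic)%E.
    move=> ab.
    have -> : `]a, b]%classic = `]-oo, b] `\` `]-oo, a].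
      by rewrite -[RHS]setCK setCD setCitvl setUC -[LHS]setCK setCitv.
    rewrite measureD ?setIidr//; first exact: subset_itvl.
    by rewrite -ge0_fin_numE// fin_num_measure.
  have [ab|ba] := leP a b; last first.
    by rewrite set_itv_ge ?measure0// bnd_simp -leNgt ltW.
  by rewrite !E// -!quantile_rv_distribution_ray.
- by move=> n; rewrite -ge0_fin_numE// fin_num_measure.
Qed.

End quantile.

Lemma quantile_nondecreasing (R : realType)
    (mu : probability (measurableTypeR R) R) (u v : R) :
  0 < u -> u <= v -> v < 1 -> quantile mu u <= quantile mu v.
Proof.
move=> u0 uv v1.
have u01 : 0 < u < 1 by lra.
have v01 : 0 < v < 1 by lra.
rewrite quantile_le// (@le_trans _ _ v%:E)//.
by rewrite -quantile_le.
Qed.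

Lemma quantile_rv_comonotone (R : realType)
    (mu nu : probability (measurableTypeR R) R) (u v : R) :
  0 <= (quantile_rv mu u - quantile_rv mu v) *
       (quantile_rv nu u - quantile_rv nu v).
Proof.
have /andP[u0 u1] := unit_clip_in01 u.
have /andP[v0 v1] := unit_clip_in01 v.
rewrite /quantile_rv.
have [uv|/ltW vu] := leP (unit_clip u) (unit_clip v).
- by rewrite mulr_le0// subr_le0; exact: quantile_nondecreasing.
- by rewrite mulr_ge0// subr_ge0; exact: quantile_nondecreasing.
Qed.

(** * The energy functional *)

Section energy_values.
Context (R : realType) (V : R -> R) (mu : probability (measurableTypeR R) R).
Local Open Scope ereal_scope.

(** Existence and finiteness of the two integrals of the energy. *)
Definition finite_energy : Prop :=
  mu.-integrable [set: measurableTypeR R] (EFin \o V) /\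
  (mu \x mu).-integrable [set: measurableTypeR R * measurableTypeR R]
    (@log_dist R).

Lemma energy_finite : finite_energy ->
  energy V mu = \int[mu]_x (V x)%:E - \int[mu \x mu]_z log_dist z.
Proof. by move=> h; rewrite /energy; case: asboolP. Qed.

Lemma energy_infinite : ~ finite_energy -> energy V mu = +oo.
Proof. by move=> h; rewrite /energy; case: asboolP. Qed.

Lemma energy_gtNy : -oo < energy V mu.
Proof.
have [h|h] := pselect finite_energy; last by rewrite energy_infinite// ltNyy.
have [Vi Li] := h.
rewrite energy_finite// ltNye_eq.
have : \int[mu]_x (V x)%:E - \int[mu \x mu]_z log_dist z \is a fin_num.
  rewrite fin_numB; apply/andP; split.
    exact: integrable_fin_num Vi.
  exact: integrable_fin_num Li.
by move=> ->.
Qed.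

End energy_values.

Lemma mule_neqNy (R : realType) (r : R) (x : \bar R) :
  0 < r -> x != -oo%E -> (r%:E * x)%E != -oo%E.
Proof. by case: x => [x| |] // r0 _; rewrite gt0_muley ?lte_fin. Qed.

(** * Displacement along a comonotone coupling *)

Section comonotone_displacement.
Context d (T : measurableType d) (R : realType) (P : probability T R).
Variables (mu1 mu2 mu3 : probability (measurableTypeR R) R).
Variables (X1 X2 : T -> measurableTypeR R) (a : R) (V1 V2 V3 : R -> R).
Hypotheses (mX1 : measurable_fun [set: T] X1)
  (mX2 : measurable_fun [set: T] X2).
Let X3 : T -> measurableTypeR R := fun w => a * X1 w + (1 - a) * X2 w.
Hypotheses
  (mu1E : forall A, measurable A -> mu1 A = P (X1 @^-1` A))
  (mu2E : forall A, measurable A -> mu2 A = P (X2 @^-1` A))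
  (mu3E : forall A, measurable A -> mu3 A = P (X3 @^-1` A)).
Hypothesis comonotone :
  forall u v, 0 <= (X1 u - X1 v) * (X2 u - X2 v).
Hypothesis a01 : 0 < a < 1.
Hypotheses (hV1 : admissible_potential V1) (hV2 : admissible_potential V2)
  (hV3 : admissible_potential V3).
Hypothesis hV : forall x y : R,
  V3 (a * x + (1 - a) * y) <= a * V1 x + (1 - a) * V2 y.

Local Open Scope ereal_scope.

Let mX3 : measurable_fun [set: T] X3.
Proof.
by apply: measurable_funD; apply: measurable_funM.
Qed.

Let f1 : T -> \bar R := (EFin \o V1) \o X1.
Let f2 : T -> \bar R := (EFin \o V2) \o X2.
Let f3 : T -> \bar R := (EFin \o V3) \o X3.
Let L1 (z : T * T) := log_dist (X1 z.1, X1 z.2).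
Let L2 (z : T * T) := log_dist (X2 z.1, X2 z.2).
Let L3 (z : T * T) := log_dist (X3 z.1, X3 z.2).

Let f3_le w : f3 w <= a%:E * f1 w + (1 - a)%:E * f2 w.
Proof. by rewrite lee_fin; exact: hV. Qed.

Let L3_ge z : a%:E * L1 z + (1 - a)%:E * L2 z <= L3 z.
Proof.
rewrite /L1 /L2 /L3 /log_dist /X3 /=.
have -> : (a * X1 z.1 + (1 - a) * X2 z.1 - (a * X1 z.2 + (1 - a) * X2 z.2) =
  a * (X1 z.1 - X1 z.2) + (1 - a) * (X2 z.1 - X2 z.2))%R by ring.
exact: lne_concave.
Qed.

Let finite_case : finite_energy V1 mu1 -> finite_energy V2 mu2 ->
  energy V3 mu3 <= a%:E * energy V1 mu1 + (1 - a)%:E * energy V2 mu2.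
Proof.
move=> h1 h2.
have [h11 h12] := h1; have [h21 h22] := h2.
have mL := @measurable_log_dist R.
have f1i : P.-integrable [set: T] f1.
  exact/(integrable_image mX1 mu1E (measurable_potential hV1)).
have f2i : P.-integrable [set: T] f2.
  exact/(integrable_image mX2 mu2E (measurable_potential hV2)).
have L1i : (P \x P).-integrable [set: T * T] L1.
  exact/(integrable_image (measurable_pair_image mX1)
    (product_image mX1 mu1E) mL).
have L2i : (P \x P).-integrable [set: T * T] L2.
  exact/(integrable_image (measurable_pair_image mX2)
    (product_image mX2 mu2E) mL).
have af1i : P.-integrable [set: T] (fun w => a%:E * f1 w).
  exact: integrableZl.
have af2i : P.-integrable [set: T] (fun w => (1 - a)%:E * f2 w).
  exact: integrableZl.
have aL1i : (P \x P).-integrable [set: T * T] (fun w => a%:E * L1 w).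
  exact: integrableZl.
have aL2i : (P \x P).-integrable [set: T * T] (fun w => (1 - a)%:E * L2 w).
  exact: integrableZl.
have f12i : P.-integrable [set: T] (fun w => a%:E * f1 w + (1 - a)%:E * f2 w).
  exact: integrableD.
have L12i : (P \x P).-integrable [set: T * T]
    (fun z => a%:E * L1 z + (1 - a)%:E * L2 z).
  exact: integrableD.
have [C HC] := potential_growth hV3.
have Ci (c : R) : P.-integrable [set: T] (cst c%:E).
  exact: finite_measure_integrable_cst.
(* [V3] along [X3] lies between [- C] and the weighted average of [V1] along
   [X1] and [V2] along [X2]. *)
have f3i : P.-integrable [set: T] f3.
  apply: (integrable_sandwich _ (Ci (- C)%R) f12i).
  - exact: measurableT_comp (measurable_potential hV3) mX3.
  - move=> w; rewrite f3_le andbT /f3 /= lee_fin.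
    have ln0 (x : R) : (0 <= ln (1 + `|x|))%R by rewrite ln_ge0// lerDl.
    by have := ln0 (X3 w); have := HC (X3 w); lra.
(* The kernel at [x = X3 u], [y = X3 v] lies between the weighted average of
   the two other kernels and [(V3 x + C) + (V3 y + C)]. *)
have L3i : (P \x P).-integrable [set: T * T] L3.
  have gi : P.-integrable [set: T] (fun w => f3 w + C%:E).
    exact: (integrableD measurableT f3i (Ci C)).
  apply: (integrable_sandwich _ L12i (integrable_marginal gi gi)).
  - exact: measurableT_comp mL (measurable_pair_image mX3).
  - move=> z; rewrite L3_ge /= (le_trans (log_dist_le _ _))// /f3 /= lee_fin.
    by have := HC (X3 z.1); have := HC (X3 z.2); lra.
have h3 : finite_energy V3 mu3.
  split; first exact/(integrable_image mX3 mu3E (measurable_potential hV3)).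
  exact/(integrable_image (measurable_pair_image mX3)
    (product_image mX3 mu3E) mL).
have Vint (m : probability (measurableTypeR R) R)
    (X : T -> measurableTypeR R) (V : R -> R) :
    measurable_fun [set: T] X ->
    (forall A, measurable A -> m A = P (X @^-1` A)) ->
    admissible_potential V -> P.-integrable [set: T] ((EFin \o V) \o X) ->
    (P \x P).-integrable [set: T * T] (fun z => log_dist (X z.1, X z.2)) ->
    \int[m]_x (V x)%:E - \int[m \x m]_z log_dist z =
    \int[P]_w (V (X w))%:E - \int[P \x P]_z log_dist (X z.1, X z.2).
  move=> mX mE aV Vi Li.
  rewrite (integral_image mX mE (measurable_potential aV))//.
  by rewrite (integral_image (measurable_pair_image mX)
    (product_image mX mE) mL).
rewrite !energy_finite// (Vint mu1 X1)// (Vint mu2 X2)// (Vint mu3 X3)//.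
rewrite -/(f1 _) -/(f2 _) -/(f3 _).
have : \int[P]_w f3 w <= a%:E * \int[P]_w f1 w + (1 - a)%:E * \int[P]_w f2 w.
  rewrite -!integralZl// -integralD//.
  by apply: le_integral => // w _; exact: f3_le.
have : a%:E * \int[P \x P]_z L1 z + (1 - a)%:E * \int[P \x P]_z L2 z <=
    \int[P \x P]_z L3 z.
  rewrite -!integralZl// -integralD//.
  by apply: le_integral => // z _; exact: L3_ge.
have /fineK <- : \int[P]_w f1 w \is a fin_num by exact: integrable_fin_num.
have /fineK <- : \int[P]_w f2 w \is a fin_num by exact: integrable_fin_num.
have /fineK <- : \int[P]_w f3 w \is a fin_num by exact: integrable_fin_num.
have /fineK <- : \int[P \x P]_w L1 w \is a fin_num by exact: integrable_fin_num.
have /fineK <- : \int[P \x P]_w L2 w \is a fin_num by exact: integrable_fin_num.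
have /fineK <- : \int[P \x P]_w L3 w \is a fin_num by exact: integrable_fin_num.
rewrite -!(EFinM, EFinD, EFinB) !lee_fin; lra.
Qed.

(** Displacement convexity of the energy along a comonotone coupling
    [(X1, X2)], for a general probability space. *)
Lemma energy_comonotone_displacement :
  energy V3 mu3 <= a%:E * energy V1 mu1 + (1 - a)%:E * energy V2 mu2.
Proof.
have /andP[a0 a1] := a01.
have [h1|h1] := pselect (finite_energy V1 mu1); last first.
  rewrite (energy_infinite h1) gt0_muley ?lte_fin// addye ?leey//.
  by rewrite mule_neqNy// ?subr_gt0// gt_eqF// energy_gtNy.
have [h2|h2] := pselect (finite_energy V2 mu2); last first.
  rewrite (energy_infinite h2) gt0_muley ?lte_fin ?subr_gt0// addey ?leey//.
  by rewrite mule_neqNy// gt_eqF// energy_gtNy.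
exact: finite_case.
Qed.

End comonotone_displacement.

(** * Comparison of the minimal energies *)

Theorem theorem6 (R : realType) (V1 V2 V3 : R -> R) (a : R)
    (mu1 mu2 mu3 : probability (measurableTypeR R) R)
    (hV1 : admissible_potential V1)
    (hV2 : admissible_potential V2)
    (hV3 : admissible_potential V3)
    (a_gt0 : 0 < a) (a_lt1 : a < 1)
    (hV : forall x y : R,
       a * V1 x + (1 - a) * V2 y >= V3 (a * x + (1 - a) * y))
    (hmu1 : energy_minimizer V1 mu1)
    (hmu2 : energy_minimizer V2 mu2)
    (hmu3 : energy_minimizer V3 mu3) :
  (a%:E * energy V1 mu1 + (1 - a)%:E * energy V2 mu2 >= energy V3 mu3)%E.
Proof.
pose X3 (u : measurableTypeR R) : measurableTypeR R :=
  a * quantile_rv mu1 u + (1 - a) * quantile_rv mu2 u.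
have mX1 := measurable_quantile_rv mu1.
have mX2 := measurable_quantile_rv mu2.
have mX3 : measurable_fun [set: measurableTypeR R] X3.
  by apply: measurable_funD; apply: measurable_funM.
pose X : {mfun measurableTypeR R >-> measurableTypeR R} :=
  HB.pack X3 (isMeasurableFun.Build _ _ _ _ _ mX3).
pose nu : probability _ _ := distribution (@unit_uniform R) X.
(* [nu] competes with the minimizer [mu3]. *)
apply: (le_trans (hmu3 nu)).
apply: (@energy_comonotone_displacement _ _ _ (@unit_uniform R) mu1 mu2 nu
  (quantile_rv mu1) (quantile_rv mu2)) => //.
- exact: quantile_rv_distribution.
- exact: quantile_rv_distribution.
- exact: quantile_rv_comonotone.
- by rewrite a_gt0.
Qed.
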